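(* Let $k$ be a field of characteristic zero, let $(R,\Delta)$ be a commutative differential $k$-algebra, and assume that $R$ is affine over $k$. Then the rule $\pi_m(Q)=(Q:\Delta)$ defines a continuous surjection $$\pi_m:\max R\rightarrow\Delta\text{-}\operatorname{prim}R.$$ If, in addition, every $\Delta$-primitive ideal of $R$ is locally closed in $\Delta\text{-}\operatorname{spec}R$, then $\Delta\text{-}\operatorname{prim}R$ is a topological quotient of $\max R$ via $\pi_m$.
   Context: Algebras are associative and unital. Affine means finitely generated as a $k$-algebra. A commutative differential $k$-algebra is a pair $(R,\Delta)$ with $R$ a commutative $k$-algebra and $\Delta$ a set of $k$-linear derivations on $R$ (no structure on $\Delta$ is assumed). A $\Delta$-ideal is an ideal $I$ with $\delta(I)\subseteq I$ for all $\delta\in\Delta$. The $\Delta$-core $(J:\Delta)$ of an ideal $J$ is the largest $\Delta$-ideal contained in $J$. A $\Delta$-prime ideal is a proper $\Delta$-ideal $Q$ such that for $\Delta$-ideals $I,J$ with $IJ\subseteq Q$, either $I\subseteq Q$ or $J\subseteq Q$. A $\Delta$-primitive ideal is an ideal of the form $(M:\Delta)$ with $M$ a maximal ideal of $R$; such ideals are $\Delta$-prime. $\max R$, $\Delta\text{-}\operatorname{spec}R$, $\Delta\text{-}\operatorname{prim}R$ denote the sets of maximal, $\Delta$-prime, and $\Delta$-primitive ideals of $R$; each of these sets $X$ has the Zariski topology, with closed sets $\{P\in X\mid P\supseteq I\}$ for ideals $I$ of $R$. A point of a topological space is locally closed if it is (relatively) closed in some neighborhood of itself. A space $Y$ is a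 topological quotient of $X$ via a surjection $\pi:X\to Y$ if the closed subsets of $Y$ are exactly the subsets $W$ with $\pi^{-1}(W)$ closed in $X$. *)

(* Defs.v *)
From HB Require Import structures.
From mathcomp Require Import all_boot all_order all_algebra.
From mathcomp Require Import all_classical topology.

Set Implicit Arguments.
Unset Strict Implicit.
Unset Printing Implicit Defensive.

Import GRing.Theory.
Local Open Scope classical_set_scope.
Local Open Scope ring_scope.

Section Ideals.
Variables (k : fieldType) (R : comAlgType k).
Implicit Types (I J M P Q : set R).

Definition affine : Prop :=
  exists s : seq R, forall S : {pred R},
    GRing.subalg_closed S -> {subset s <= S} -> forall x : R, x \in S.

Record derivation := Derivation {
  derivation_fun :> {linear R -> R};
  derivationM : forall x y : R,
    derivation_fun (x * y) = derivation_fun x * y + x * derivation_fun y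
}.

(* Ideals may be improper, unlike those of [ring_quotient]. *)
Definition is_ideal I : Prop :=
  [/\ I 0, forall x y, I x -> I y -> I (x + y) & forall a x, I x -> I (a * x)].

Definition maximal_ideal M : Prop :=
  [/\ is_ideal M, M <> setT &
      forall J, is_ideal J -> M `<=` J -> J = M \/ J = setT].

Definition ideal_mul I J : set R :=
  [set z | exists n (x y : 'I_n -> R),
    [/\ forall i, I (x i), forall i, J (y i) & z = \sum_(i < n) x i * y i]].

Lemma ideal_mul_subl I J : is_ideal I -> ideal_mul I J `<=` I.
Proof.
move=> [I0 ID IM] _ [n [x [y [Ix _ ->]]]].
by elim/big_ind: _ => // i _; rewrite mulrC; apply: IM.
Qed.

Lemma ideal_mul_subr I J : is_ideal J -> ideal_mul I J `<=` J.
Proof.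
move=> [J0 JD JM] _ [n [x [y [_ Jy ->]]]].
by elim/big_ind: _ => // i _; apply: JM.
Qed.

Lemma ideal_mulM I J x y : I x -> J y -> ideal_mul I J (x * y).
Proof.
move=> Ix Jy; exists 1%N, (fun=> x), (fun=> y); split=> //.
by rewrite big_ord1.
Qed.

Lemma ideal1 I : is_ideal I -> I 1 -> I = setT.
Proof.
move=> [_ _ IM] I1; apply/seteqP; split=> // x _.
by rewrite -(mulr1 x); apply: IM.
Qed.

Definition ideal_add I J : set R :=
  [set z | exists x y, [/\ I x, J y & z = x + y]].

Lemma is_ideal_add I J : is_ideal I -> is_ideal J -> is_ideal (ideal_add I J).
Proof.
move=> [I0 ID IM] [J0 JD JM]; split.
- by exists 0, 0; rewrite addr0.
- move=> _ _ [x [y [Ix Jy ->]]] [x' [y' [Ix' Jy' ->]]].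
  by exists (x + x'), (y + y'); split; [exact: ID|exact: JD|rewrite addrACA].
- move=> a _ [x [y [Ix Jy ->]]].
  by exists (a * x), (a * y); split; [exact: IM|exact: JM|rewrite mulrDr].
Qed.

Lemma ideal_add_subl I J : is_ideal J -> I `<=` ideal_add I J.
Proof. by move=> [J0 _ _] x Ix; exists x, 0; rewrite addr0. Qed.

Lemma ideal_add_subr I J : is_ideal I -> J `<=` ideal_add I J.
Proof. by move=> [I0 _ _] x Jx; exists 0, x; rewrite add0r. Qed.

Lemma maximal_ideal_prime M I J : maximal_ideal M -> is_ideal I ->
  is_ideal J -> ideal_mul I J `<=` M -> I `<=` M \/ J `<=` M.
Proof.
move=> [idM MT maxM] idI idJ IJM.
have [IM|IM] := maxM _ (is_ideal_add idM idI) (@ideal_add_subl _ _ idI).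
  by left; rewrite -IM; exact: ideal_add_subr.
right=> y Jy; have : ideal_add M I 1 by rewrite IM.
move=> [m [x [Mm Ix e]]]; case: idM => _ MD MM.
rewrite -(mul1r y) e mulrDl; apply: MD; first by rewrite mulrC; apply: MM.
by apply: IJM; exact: ideal_mulM.
Qed.

Section Differential.
Variable Delta : set derivation.

Definition delta_ideal I : Prop :=
  is_ideal I /\ forall d, Delta d -> forall x, I x -> I (d x).

(* The union of all Delta-ideals inside [J]; see [delta_core_largest]. *)
Definition delta_core J : set R :=
  \bigcup_(I in [set I | delta_ideal I /\ I `<=` J]) I.

Lemma delta_ideal_add I J :
  delta_ideal I -> delta_ideal J -> delta_ideal (ideal_add I J).
Proof.
move=> [idI dI] [idJ dJ]; split; first exact: is_ideal_add.
move=> d Dd _ [x [y [Ix Jy ->]]].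
by exists (d x), (d y); rewrite raddfD; split=> //; [exact: dI|exact: dJ].
Qed.

Lemma delta_core_largest J : is_ideal J ->
  [/\ delta_ideal (delta_core J), delta_core J `<=` J &
      forall I, delta_ideal I -> I `<=` J -> I `<=` delta_core J].
Proof.
move=> [J0 JD JM]; split; first split; first split.
- exists [set 0] => //; split; last by move=> _ ->.
  by split; [split=> [//|_ _ -> ->|a _ ->]; rewrite /= ?addr0 ?mulr0|
             move=> d _ _ ->; rewrite /= raddf0].
- move=> x y [I1 [dI1 I1J] I1x] [I2 [dI2 I2J] I2y].
  exists (ideal_add I1 I2); last by exists x, y.
  split; first exact: delta_ideal_add.
  by move=> _ [u [v [Iu Iv ->]]]; apply: JD; [exact: I1J|exact: I2J].
- by move=> a x [I [dI IJ] Ix]; exists I => //; case: dI => -[_ _ +] _; exact.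
- by move=> d Dd x [I [dI IJ] Ix]; exists I => //; case: dI => _; exact.
- by move=> x [I [_ +] Ix]; exact.
- by move=> I dI IJ x Ix; exists I.
Qed.

Definition delta_prime Q : Prop :=
  [/\ delta_ideal Q, Q <> setT &
      forall I J, delta_ideal I -> delta_ideal J -> ideal_mul I J `<=` Q ->
        I `<=` Q \/ J `<=` Q].

Definition delta_primitive P : Prop :=
  exists2 M, maximal_ideal M & P = delta_core M.

Lemma delta_primitive_prime P : delta_primitive P -> delta_prime P.
Proof.
move=> [M maxM ->]; have [idM MT _] := maxM.
have [dC CM largest] := delta_core_largest idM.
split=> // [CT|I J dI dJ IJC].
  by apply: MT; apply/seteqP; split=> // x _; apply: CM; rewrite CT.
have [] := maximal_ideal_prime maxM (proj1 dI) (proj1 dJ)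
  (subset_trans IJC CM) => [IM|JM]; [left|right]; exact: largest.
Qed.

Definition delta_hull I : set R :=
  \bigcap_(J in [set J | delta_ideal J /\ I `<=` J]) J.

Lemma delta_ideal_hull I : delta_ideal (delta_hull I).
Proof.
split; first split.
- by move=> J [[[]]].
- move=> x y Ix Iy J JI; have [[[_ JD _] _] _] := JI.
  by apply: JD; [exact: Ix|exact: Iy].
- by move=> a x Ix J JI; have [[[_ _ JM] _] _] := JI; apply: JM; exact: Ix.
- by move=> d Dd x Ix J JI; have [[_ dJ] _] := JI; apply: dJ => //; exact: Ix.
Qed.

Lemma delta_hull_sub I Q : delta_ideal Q ->
  (delta_hull I `<=` Q) = (I `<=` Q).
Proof.
move=> dQ; apply/propext; split=> [HQ x Ix|IQ x]; last exact.
by apply: HQ => J [_ +]; exact.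
Qed.

Lemma delta_ideal_cap I J :
  delta_ideal I -> delta_ideal J -> delta_ideal (I `&` J).
Proof.
move=> [[I0 ID IM] dI] [[J0 JD JM] dJ]; split; first split=> //.
- by move=> x y [? ?] [? ?]; split; [exact: ID|exact: JD].
- by move=> a x [? ?]; split; [exact: IM|exact: JM].
- by move=> d Dd x [? ?]; split; [exact: dI|exact: dJ].
Qed.

End Differential.

Lemma maximal_ideal_prime_set0 : maximal_ideal `<=` delta_prime set0.
Proof.
move=> M maxM; have [idM MT _] := maxM; split=> // I J [idI _] [idJ _].
exact: maximal_ideal_prime.
Qed.

End Ideals.

Section Zariski.
Variables (k : fieldType) (R : comAlgType k) (Delta : set (derivation R)).

(* A set [X] of ideals with the Zariski topology. That the sets [zariski_zeros]
   are stable under finite unions requires the members of [X] to be prime in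
   some sense, hence the (otherwise unused) argument of type
   [X `<=` delta_prime Delta]. *)
Record zariski (X : set (set R)) (X_prime : X `<=` delta_prime Delta) := Zariski {
  zariski_ideal :> set R;
  zariski_ideal_mem : X zariski_ideal
}.

Variables (X : set (set R)) (X_prime : X `<=` delta_prime Delta).
Local Notation T := (zariski X_prime).

HB.instance Definition _ := gen_eqMixin T.
HB.instance Definition _ := gen_choiceMixin T.

Lemma zariski_ideal_inj : injective (@zariski_ideal X X_prime).
Proof.
move=> [P XP] [Q XQ] /= PQ; rewrite PQ in XP *.
by rewrite (Prop_irrelevance XP XQ).
Qed.

Definition zariski_zeros (I : set R) : set T :=
  [set P | I `<=` P].

Definition zariski_open (U : set T) : Prop :=
  exists2 I, is_ideal I & ~` U = zariski_zeros I.

Lemma zariski_openT : zariski_open setT.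
Proof.
exists setT; first by split.
rewrite setCT; apply/seteqP; split=> // P /= TP.
have [_ + _] := X_prime (zariski_ideal_mem P); apply.
by apply/seteqP; split.
Qed.

Lemma zariski_openI : setI_closed zariski_open.
Proof.
move=> U V [I idI UI] [J idJ VJ]; rewrite /zariski_open setCI UI VJ.
have dI := delta_ideal_hull Delta I; have dJ := delta_ideal_hull Delta J.
exists (delta_hull Delta I `&` delta_hull Delta J).
  exact: (proj1 (delta_ideal_cap dI dJ)).
apply/seteqP; split=> P; have [dP _ primeP] := X_prime (zariski_ideal_mem P).
  rewrite /zariski_zeros /=; rewrite -(delta_hull_sub I dP).
  by rewrite -(delta_hull_sub J dP) => -[IP|JP] x [? ?]; [exact: IP|exact: JP].
move=> IJP; have [] := primeP _ _ dI dJ.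
- move=> x IJx; apply: IJP; split.
    exact: (ideal_mul_subl (proj1 dI) IJx).
  exact: (ideal_mul_subr (proj1 dJ) IJx).
- by rewrite delta_hull_sub //; left.
- by rewrite delta_hull_sub //; right.
Qed.

Lemma zariski_open_bigU (A : Type) (f : A -> set T) :
  (forall i, zariski_open (f i)) -> zariski_open (\bigcup_i f i).
Proof.
move=> fo; pose S : set R :=
  [set x | exists i I, [/\ is_ideal I, ~` f i = zariski_zeros I & I x]].
exists (delta_hull set0 S); first exact: (proj1 (delta_ideal_hull set0 S)).
apply/seteqP; split=> P; rewrite /zariski_zeros /= delta_hull_sub; last 1 first.
- by have [[]] := X_prime (zariski_ideal_mem P).
- move=> nP x [i [I [_ fI Ix]]].
  by have : (~` f i) P by [move=> fP; apply: nP; exists i]; rewrite fI; apply.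
- by have [[]] := X_prime (zariski_ideal_mem P).
- move=> SP [i _ fiP]; have [I idI fI] := fo i.
  suff : (~` f i) P by apply.
  by rewrite fI => x Ix; apply: SP; exists i, I.
Qed.

HB.instance Definition _ := isOpenTopological.Build T
  zariski_openT zariski_openI zariski_open_bigU.

Lemma zariski_closedP (A : set T) :
  closed A <-> exists2 I, is_ideal I & A = zariski_zeros I.
Proof.
by rewrite -openC; split=> -[I idI e]; exists I; rewrite ?setCK // -e setCK.
Qed.

End Zariski.

Section Spectra.
Variables (k : fieldType) (R : comAlgType k) (Delta : set (derivation R)).

(* Maximal ideals are the prime ideals required by [zariski] for [Delta = set0]. *)
Definition maxspec : Type := zariski (@maximal_ideal_prime_set0 k R).
Definition delta_spec : Type := zariski (@subset_refl _ (delta_prime Delta)).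
Definition delta_prim : Type := zariski (@delta_primitive_prime k R Delta).

HB.instance Definition _ := Topological.on maxspec.
HB.instance Definition _ := Topological.on delta_spec.
HB.instance Definition _ := Topological.on delta_prim.

Lemma pi_m_subproof (M : maxspec) : delta_primitive Delta (delta_core Delta M).
Proof. by exists M => //; exact: zariski_ideal_mem. Qed.

Definition pi_m (M : maxspec) : delta_prim := Zariski _ (pi_m_subproof M).

End Spectra.

Definition locally_closed_point (T : topologicalType) (x : T) : Prop :=
  exists2 U : set T, nbhs x U & exists2 C, closed C & C `&` U = [set x].

Definition topological_quotient (X Y : topologicalType) (pi : X -> Y) : Prop :=
  set_surj setT setT pi /\ forall W : set Y, closed W <-> closed (pi @^-1` W).

(* Main.v *)
(* If [W] is a set of Delta-primitive ideals whose preimage is the set of maximal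
   ideals above [I], then [W] consists of all the Delta-primitive ideals above
   [I]. One inclusion holds because [(M : Delta)] is contained in [M]. For the
   other, let [P] be in [W]. In characteristic zero [P] is prime. As [P] is locally
   closed, there is [l] outside [P] such that every maximal ideal [M] above [P]
   with [l] not in [M] lies in the fibre over [P], hence contains [I]. Since [R] is
   a Jacobson ring, these [M] intersect in [P], so that [P] contains [I].

   Delta-cores of primes are prime: for one derivation this follows from the
   Leibniz formula, and in general a prime minimal between [(M : Delta)] and [M]
   equals its core with respect to each derivation, hence is a Delta-ideal.

   The Jacobson property is proved as by Goldman: an ideal [P] maximal among those
   avoiding the powers of [f] is prime, and [(R/P)[1/f]] is a field. This property
   descends from [A[x]] to [A] and forces [x] to be algebraic over [A], so that
   [R/P] is reached from [k] by successive algebraic extensions. *)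
From HB Require Import structures.
Require Import Defs.
From mathcomp Require Import all_boot all_order all_algebra.
From mathcomp Require Import all_classical topology ring.

Set Implicit Arguments.
Unset Strict Implicit.
Unset Printing Implicit Defensive.

Import GRing.Theory.
Local Open Scope classical_set_scope.
Local Open Scope ring_scope.

(* The element [b] is such that every nonzero element of [S] divides a power of
   it, that is, [S[1/b]] is a field. *)
Definition goldman (L : fieldType) (S : set L) : Prop :=
  exists b, [/\ S b, b != 0 &
    forall y, S y -> y != 0 -> exists2 c, S c & exists n, y * c = b ^+ n].

Definition inv_closed (L : fieldType) (S : set L) : Prop :=
  forall y, S y -> S y^-1.

(** * Goldman's condition for finitely generated extensions inside a field *)

Section Adjoin.
Variables (A : comNzRingType) (L : fieldType) (phi : {rmorphism A -> L}).
Implicit Types (x y z : L).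

(** Subrings of [L] are handled as ranges of morphisms; the range here is [phi(A)[x]]. *)
Definition adjoin x : {rmorphism {poly A} -> L} :=
  horner_morph ((fun a => mulrC x (phi a)) : commr_rmorph phi x).

Lemma adjoinE x p : adjoin x p = (map_poly phi p).[x].
Proof. by []. Qed.

Lemma adjoin_id x : range (adjoin x) x.
Proof. by exists 'X => //; rewrite adjoinE map_polyX hornerX. Qed.

Lemma sub_adjoin x : range phi `<=` range (adjoin x).
Proof.
by move=> _ [a _ <-]; exists a%:P => //; rewrite adjoinE map_polyC hornerC.
Qed.

(* The witness [r] is the lowest nonzero coefficient of [p]. *)
Lemma root_dvd_const b p : b != 0 -> map_poly phi p != 0 ->
  root (map_poly phi p) b ->
  exists r q, phi r != 0 /\ phi r = b * adjoin b q.
Proof.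
move=> b0; elim/poly_ind: p => [|p c IH]; first by rewrite rmorph0 eqxx.
rewrite rmorphD rmorphM /= map_polyX map_polyC /=.
have [c0|c0] := eqVneq (phi c) 0.
  rewrite c0 polyC0 addr0 mulf_eq0 polyX_eq0 orbF => p0.
  by rewrite rootM rootX (negbTE b0) orbF; exact: IH.
move=> _ /rootP; rewrite hornerD hornerM hornerX hornerC => e.
exists c, (- p); split=> //.
rewrite adjoinE rmorphN hornerN mulrN mulrC.
by apply/eqP; rewrite -addr_eq0 addrC e.
Qed.

(** Multiplying a monic equation of degree [m] for [z] by [phi y ^+ m] turns it into one for [phi s]
    whose lower terms all carry a factor [phi y]. *)
Lemma integral_dvd z (s y : A) : integralOver phi z -> phi s = phi y * z ->
  exists t m, phi s ^+ m = phi y * phi t.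
Proof.
move=> [p mp /rootP pz] e.
have := pz; rewrite (@horner_coef_wide _ (size p)) ?size_poly //.
move: (monicP mp); rewrite lead_coefE; have := monic_neq0 mp.
rewrite -size_poly_gt0; case: (size p) => // m _ /= pm.
rewrite big_ord_recr /= coef_map /= pm rmorph1 mul1r.
move=> /(congr1 (GRing.mul (phi y ^+ m))).
rewrite mulr0 mulrDr -exprMn -e => /eqP; rewrite addrC addr_eq0 => /eqP es.
exists (- \sum_(i < m) p`_i * s ^+ i * y ^+ (m.-1 - i)), m; rewrite es.
rewrite rmorphN mulrN rmorph_sum !mulr_sumr; congr (- _); apply: eq_bigr => i _.
rewrite coef_map /= !rmorphM !rmorphXn e exprMn.
have -> : phi y ^+ m = phi y ^+ i * phi y * phi y ^+ (m.-1 - i).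
  have m0 : (0 < m)%N := leq_ltn_trans (leq0n i) (ltn_ord i).
  by rewrite -exprSr -exprD addSn subnKC ?prednK // -ltnS prednK.
ring.
Qed.

Lemma adjoin_goldman_root x : goldman (range (adjoin x)) ->
  exists2 p, map_poly phi p != 0 & root (map_poly phi p) x.
Proof.
move=> [_ [[b _ <-] b0 bP]].
have bX0 : map_poly phi b != 0.
  by apply: contra_neq b0 => b0; rewrite adjoinE b0 horner0.
pose u := 1 + 'X * b.
(* If [x] were transcendental, [u = 1 + 'X * b] would divide a power of [b],
   to which it is coprime. *)
have [e|ne] := eqVneq (adjoin x u) 0.
  exists u; last exact/rootP.
  apply/eqP => /(congr1 (fun q : {poly L} => q`_0)).
  rewrite coef_map /= coefD coefXM coef1 addr0 coef0 rmorph1.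
  by apply/eqP/oner_neq0.
have [_ [c _ <-] [n e]] := bP _ (ex_intro2 _ _ _ I erefl) ne.
exists (u * c - b ^+ n); last first.
  by apply/rootP; rewrite -adjoinE rmorphB rmorphM rmorphXn e subrr.
rewrite rmorphB rmorphM rmorphXn subr_eq0; apply/eqP => uc.
have ub : coprimep (map_poly phi u) (map_poly phi b).
  by rewrite rmorphD rmorphM rmorph1 /= addrC coprimep_sym coprimep_addl_mul
    coprimep1.
have := coprimep_expr n ub; rewrite -uc => /(coprimep_dvdl (dvdp_mulIl _ _)).
(* A polynomial coprime to itself is constant, but the image of [u] has positive degree because that
   of [b] is nonzero. *)
rewrite coprimepp rmorphD rmorphM rmorph1 /= map_polyX addrC size_polyDl.
  by rewrite mulrC size_mulX // eqSS size_poly_eq0 (negbTE bX0).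
by rewrite mulrC size_mulX // size_poly1 ltnS lt0n size_poly_eq0.
Qed.

Lemma adjoin_clear_denom (a : A) (r : {poly A}) : phi a != 0 ->
  exists s n, phi s = adjoin (phi a)^-1 r * phi a ^+ n.
Proof.
move=> a0; elim/poly_ind: r => [|r c [s [n e]]].
  by exists 0, 0%N; rewrite !rmorph0 mul0r.
exists (s + c * a ^+ n.+1), n.+1.
rewrite !rmorphD !rmorphM rmorphXn /= e !adjoinE map_polyX map_polyC hornerX
  hornerC.
by rewrite exprS mulrDl -!mulrA mulKf.
Qed.

End Adjoin.

(** The constant [r] from an equation of [b] is a multiple of [b]. A nonzero [y] of [phi(A)] divides
    a power of [b], hence a power of [r] up to an integral cofactor, which [integral_dvd] replaces
    by one in [phi(A)[1/a]]. Clearing denominators in [r] leads to the witness [s * a]. *)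
Lemma goldman_adjoin (A : comNzRingType) (L : fieldType)
    (phi : {rmorphism A -> L}) (x : L) :
  goldman (range (adjoin phi x)) -> goldman (range phi).
Proof.
move=> gx; have [p p0 px] := adjoin_goldman_root gx.
(* With [a] the leading coefficient of [p], everything in [phi(A)[x]] is integral
   over [phi(A)[1/a]], the image of [phia]. *)
pose q := map_poly phi p; pose a := p`_(size q).-1.
have ea : phi a = lead_coef q by rewrite lead_coefE coef_map.
have a0 : phi a != 0 by rewrite ea lead_coef_eq0.
pose phia := adjoin phi (phi a)^-1.
have phiaC c : phia c%:P = phi c by rewrite /phia adjoinE map_polyC hornerC.
have int_phi c : integralOver phia (phi c).
  by rewrite -phiaC; exact: integral_id.
have int_x : integralOver phia x.
  apply: (@integral_root_monic _ _ _ _ ((phi a)^-1 *: q)).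
  - by apply/monicP; rewrite lead_coefZ ea mulVf // -ea.
  - by rewrite rootZ // invr_eq0.
  apply/integral_poly => i; rewrite coefZ coef_map.
  apply: integral_mul; last exact: int_phi.
  by have [c' _ <-] := adjoin_id phi (phi a)^-1; exact: integral_id.
have int_adj c : integralOver phia (adjoin phi x c).
  apply: integral_horner => //; apply/integral_poly => i.
  by rewrite coef_map; exact: int_phi.
have [_ [[b0 _ <-] b_neq0 bP]] := gx; set b := adjoin phi x b0 in b_neq0 bP.
have [m mm mb] := int_adj b0.
have mapm0 : map_poly phia m != 0 by rewrite monic_neq0 ?monic_map.
have [r [d [r0 rd]]] := root_dvd_const b_neq0 mapm0 mb.
have [s [K es]] := adjoin_clear_denom r a0.
exists (phi (s * a)); split; first by exists (s * a).
  by rewrite rmorphM es !mulf_neq0 // expf_neq0.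
move=> _ [y _ <-] y0.
have [_ [c _ <-] [n e]] := bP _ (sub_adjoin x (ex_intro2 _ _ y I erefl)) y0.
have int_d : integralOver phia (adjoin phia b d).
  apply: integral_horner; last exact: int_adj.
  apply/integral_poly => i; rewrite coef_map; exact: integral_id.
(* This [z] is the quotient of [phia r ^+ n] by [phi y]. *)
pose z := adjoin phi x c * adjoin phia b d ^+ n.
have int_z : integralOver phia z.
  apply: integral_mul => //; elim: n {e z} => [|n IH]; first exact: integral1.
  by rewrite exprS; exact: integral_mul.
have ez : phia (r ^+ n) = phia y%:P * z.
  by rewrite phiaC /z mulrA e -exprMn -rd rmorphXn.
have [t [N]] := integral_dvd int_z ez; rewrite phiaC rmorphXn -exprM => et.
have [t' [J et']] := adjoin_clear_denom t a0.
(* The numerator [t'] absorbs [a ^+ J], and [a ^+ (K * (n * N))] comes from replacing [s] by [r]. *)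
exists (phi (t' * a ^+ (K * (n * N)) * (s ^+ J * a ^+ (n * N)))).
  by eexists.
exists (n * N + J)%N.
rewrite !rmorphM !rmorphXn /= es et' exprMn !exprD !exprMn -!exprM et -/phia.
rewrite -/phia in et *; ring: et.
Qed.

(** As [phi(A)] is a field, [x] is integral over it, and so is [b]. The constant [r] from an
    equation of [b] is then an invertible multiple of [b], so [b] is invertible in [phi(A)[x]], and
    with it every nonzero element, as a divisor of a power of [b]. *)
Lemma adjoin_inv_closed (A : comNzRingType) (L : fieldType)
    (phi : {rmorphism A -> L}) (x : L) :
  inv_closed (range phi) -> goldman (range (adjoin phi x)) ->
  inv_closed (range (adjoin phi x)).
Proof.
move=> inv_phi gx; have [p p0 px] := adjoin_goldman_root gx.
have int_phi c : integralOver phi (phi c) by exact: integral_id.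
have int_x : integralOver phi x.
  apply: (@integral_root_monic _ _ _ _
    ((lead_coef (map_poly phi p))^-1 *: map_poly phi p)).
  - by apply/monicP; rewrite lead_coefZ mulVf // lead_coef_eq0.
  - by rewrite rootZ // invr_eq0 lead_coef_eq0.
  apply/integral_poly => i; rewrite coefZ coef_map.
  apply: integral_mul; last exact: int_phi.
  rewrite lead_coefE coef_map /=.
  pose c0 := p`_(size (map_poly phi p)).-1.
  by have [c _ <-] := inv_phi _ (ex_intro2 _ _ c0 I erefl).
have [_ [[b0 _ <-] b_neq0 bP]] := gx; set b := adjoin phi x b0 in b_neq0 bP.
have [m mm mb] : integralOver phi b.
  apply: integral_horner => //; apply/integral_poly => i.
  by rewrite coef_map; exact: int_phi.
have mapm0 : map_poly phi m != 0 by rewrite monic_neq0 ?monic_map.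
have [r [d [r0 rd]]] := root_dvd_const b_neq0 mapm0 mb.
have [r' _ er'] := inv_phi _ (ex_intro2 _ _ r I erefl).
have bV : range (adjoin phi x) b^-1.
  (* The inverse is [r^-1 * d(b)]; composing with [b0] writes [d(b)] as a polynomial in [x]. *)
  exists (r'%:P * (d \Po b0)) => //.
  rewrite rmorphM [adjoin phi x r'%:P]adjoinE map_polyC hornerC /= er' rd.
  rewrite [adjoin phi x _]adjoinE map_comp_poly horner_comp -!adjoinE -/b.
  rewrite mulrC invfM mulrCA mulfV ?mulr1 //.
  by move: r0; rewrite rd mulf_eq0 negb_or => /andP[].
move=> _ [y _ <-]; have [->|y0] := eqVneq (adjoin phi x y) 0.
  by rewrite invr0; exists 0 => //; rewrite rmorph0.
have [_ [c _ <-] [n e]] := bP _ (ex_intro2 _ _ y I erefl) y0.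
have [b' _ eb'] := bV.
exists (c * b' ^+ n) => //.
rewrite rmorphM rmorphXn eb' exprVn -e invfM mulrCA mulfV ?mulr1 //.
by apply: contraTneq (expf_neq0 n b_neq0) => c0; rewrite -e c0 mulr0 eqxx.
Qed.

(** The subring generated by [s] over [phi(A)]. The source ring changes at each step, so only the
    image in [L] is kept. *)
Fixpoint adjoin_seq (L : fieldType) (s : seq L) (A : comNzRingType)
    (phi : {rmorphism A -> L}) : set L :=
  if s is x :: s' then adjoin_seq s' (adjoin phi x) else range phi.

Section AdjoinSeq.
Variable L : fieldType.

Lemma goldman_adjoin_seq s (A : comNzRingType) (phi : {rmorphism A -> L}) :
  goldman (adjoin_seq s phi) -> goldman (range phi).
Proof. by elim: s A phi => //= x s IH A phi /IH /goldman_adjoin. Qed.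

(** Goldman's condition descends from the whole extension to every intermediate ring, so
    [adjoin_inv_closed] applies to one generator after another. *)
Lemma adjoin_seq_inv_closed s (A : comNzRingType) (phi : {rmorphism A -> L}) :
  inv_closed (range phi) -> goldman (adjoin_seq s phi) ->
  inv_closed (adjoin_seq s phi).
Proof.
elim: s A phi => //= x s IH A phi inv_phi g; apply: IH => //.
by apply: adjoin_inv_closed => //; exact: goldman_adjoin_seq g.
Qed.

Lemma adjoin_seq_sub (S : set L) s (A : comNzRingType)
    (phi : {rmorphism A -> L}) :
  (forall x y, S x -> S y -> S (x + y)) ->
  (forall x y, S x -> S y -> S (x * y)) ->
  range phi `<=` S -> {in s, forall x, S x} -> adjoin_seq s phi `<=` S.
Proof.
move=> SD SM; elim: s A phi => //= x s IH A phi phiS xsS; apply: IH.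
  move=> _ [p _ <-]; elim/poly_ind: p => [|p c IHp].
    by rewrite rmorph0; apply: phiS; exists 0 => //; rewrite rmorph0.
  rewrite rmorphD rmorphM /=; apply: SD; first apply: SM => //.
    by rewrite adjoinE map_polyX hornerX; apply: xsS; rewrite mem_head.
  by rewrite adjoinE map_polyC hornerC; apply: phiS; exists c.
by move=> y ys; apply: xsS; rewrite inE ys orbT.
Qed.

Lemma adjoin_seqP s (A : comNzRingType) (phi : {rmorphism A -> L}) :
  let S := adjoin_seq s phi in
  [/\ range phi `<=` S, {in s, forall x, S x},
    forall x y, S x -> S y -> S (x - y) &
    forall x y, S x -> S y -> S (x * y)].
Proof.
elim: s A phi => [|x s IH] A phi /=.
  split=> // _ _ [a _ <-] [b _ <-].
    by exists (a - b) => //; rewrite rmorphB.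
  by exists (a * b) => //; rewrite rmorphM.
have [sub_phi sub_s SB SM] := IH _ (adjoin phi x); split=> //.
  exact: subset_trans (@sub_adjoin _ _ phi x) sub_phi.
move=> y; rewrite inE => /predU1P[->|/sub_s//].
by apply: sub_phi; exact: adjoin_id.
Qed.

End AdjoinSeq.

(** * Prime ideals and their residue fields *)

Section Residue.
Local Open Scope quotient_scope.

Lemma integral_fraction_field (D : comNzRingType) :
  GRing.integral_domain_axiom D ->
  exists (L : fieldType) (iota : {rmorphism D -> L}), injective iota.
Proof.
move=> intD.
(* [{fraction _}] needs a unit predicate and an inverse function; classical choice supplies both,
   nonunits being sent to themselves. *)
pose inv x := xget x [set y : D | y * x = 1].
pose unit : pred D := fun x => `[< exists y, y * x = 1 >].
have mulVx : {in unit, left_inverse 1 inv *%R}.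
  move=> x /asboolP ex; rewrite /inv.
  by case: xgetP => // /(_ _ (proj2_sig (cid ex))).
have unitPl x y : y * x = 1 -> unit x by move=> yx; apply/asboolP; exists y.
have inv_out : {in [predC unit], inv =1 id}.
  move=> x /negP nx; rewrite /inv; case: xgetP => // y _ yx.
  by case: nx; apply/asboolP; exists y.
pose U : comUnitRingType := HB.pack D
  (GRing.ComNzRing_hasMulInverse.Build D mulVx unitPl inv_out).
pose E : idomainType := HB.pack (GRing.ComUnitRing.sort U)
  (GRing.ComUnitRing_isIntegral.Build U intD).
pose iota : {rmorphism E -> {fraction E}} := @tofrac E.
exists {fraction E}, iota => x y /eqP.
by rewrite tofrac_eq => /eqP.
Qed.

Lemma prime_idealr_residue (R : comNzRingType) (I : prime_idealr R) :
  exists (L : fieldType) (rho : {rmorphism R -> L}),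
    forall x, (rho x == 0) = (x \in I).
Proof.
have [L [iota iotaI]] :=
  integral_fraction_field (@Quotient.rquot_IdomainAxiom R I).
exists L, (iota \o \pi_{ideal_quot I}) => x /=.
have e0 : \pi_{ideal_quot I} 0 = 0 by exact: rmorph0.
by rewrite -(rmorph0 iota) (inj_eq iotaI) -e0 -Quotient.idealrBE subr0.
Qed.

End Residue.

Section Prime.
Variables (k : fieldType) (R : comAlgType k).
Implicit Types (I J M P Q : set R).

Definition prime_ideal P : Prop :=
  [/\ is_ideal P, ~ P 1 & forall x y, P (x * y) -> P x \/ P y].

Lemma prime_idealX P x n : prime_ideal P -> P (x ^+ n) -> P x.
Proof.
move=> [idP P1 PM]; elim: n => [//|n IH].
by rewrite exprS => /PM[].
Qed.

Lemma idealN I x : is_ideal I -> I x -> I (- x).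
Proof. by move=> [_ _ IM] Ix; rewrite -mulN1r; exact: IM. Qed.

Lemma idealB I x y : is_ideal I -> I x -> I y -> I (x - y).
Proof.
by move=> idI Ix Iy; have [_ ID _] := idI; apply: ID => //; exact: idealN.
Qed.

Lemma prime_ideal_residue P : prime_ideal P ->
  exists (L : fieldType) (rho : {rmorphism R -> L}),
    forall x, rho x = 0 <-> P x.
Proof.
move=> [idP P1 PM]; have [P0 PD PMl] := idP.
pose S : {pred R} := fun x => `[< P x >].
have SP x : reflect (P x) (x \in S) by exact: asboolP.
have idS : idealr_closed S.
  split; [exact/SP|exact/SP|].
  by move=> a x y /SP Px /SP Py; apply/SP/PD => //; exact: PMl.
have prS : prime_idealr_closed S.
  by move=> x y /SP/PM[]/SP ->; rewrite ?orbT.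
pose pS : prime_idealr R :=
  HB.pack S (isIdealr.Build R S idS) (isPrimeIdealrClosed.Build R S prS).
have [L [rho rhoE]] := prime_idealr_residue pS.
exists L, rho => x; split=> [/eqP|Px]; first by rewrite rhoE => /SP.
by apply/eqP; rewrite rhoE; apply/SP.
Qed.

End Prime.

(** Adjoining [A] to every set makes the empty chain harmless, its union becoming [A]. *)
Lemma Zorn_bigcup_above (T : Type) (P : set (set T)) (A : set T) : P A ->
  (forall F : set (set T), F !=set0 -> F `<=` P -> total_on F subset ->
    P (\bigcup_(X in F) X)) ->
  exists B, [/\ P B, A `<=` B & forall C, P C -> B `<=` C -> C = B].
Proof.
move=> PA Pcup.
have [F FP totF|B [PB maxB]] := @Zorn_bigcup _ [set X | P (X `|` A)].
  have [->|/set0P[X0 FX0]] := eqVneq F set0.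
    by rewrite /= bigcup_set0 set0U.
  rewrite /= (_ : _ `|` A = \bigcup_(Y in [set X `|` A | X in F]) Y).
    apply: Pcup; first by exists (X0 `|` A), X0.
      by move=> _ [X FX <-]; exact: FP.
    move=> _ _ [X FX <-] [Y FY <-].
    by have [XY|YX] := totF _ _ FX FY; [left|right]; exact: setSU.
  apply/seteqP; split=> [x [[X FX Xx]|Ax]|x [_ [X FX <-] [Xx|Ax]]].
  - by exists (X `|` A); [exists X|left].
  - by exists (X0 `|` A); [exists X0|right].
  - by left; exists X.
  - by right.
exists (B `|` A); split=> // C PC BC; apply: contrapT => CB.
apply: (maxB C).
  split=> [x Bx|CB']; first by apply: BC; left.
  by apply: CB; apply/seteqP; split=> // x /CB'; left.
by rewrite /= setUidl // => x Ax; apply: BC; right.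
Qed.

(** * The Jacobson property of affine algebras *)

Section Jacobson.
Variables (k : fieldType) (R : comAlgType k).
Implicit Types (I J M P Q : set R).

Lemma is_ideal_bigcup (F : set (set R)) : F !=set0 -> total_on F subset ->
  (forall I, F I -> is_ideal I) -> is_ideal (\bigcup_(I in F) I).
Proof.
move=> [I0 FI0] totF idF; split.
- by exists I0 => //; case: (idF _ FI0).
- move=> x y [I FI Ix] [J FJ Jy].
  have [IJ|JI] := totF _ _ FI FJ.
    by exists J => //; have [_ JD _] := idF _ FJ; apply: JD => //; exact: IJ.
  by exists I => //; have [_ ID _] := idF _ FI; apply: ID => //; exact: JI.
- by move=> a x [I FI Ix]; exists I => //; have [_ _] := idF _ FI; exact.
Qed.

Lemma is_ideal_principal (x : R) : is_ideal (range (GRing.mul x)).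
Proof.
split; first by exists 0; rewrite ?mulr0.
  by move=> _ _ [a _ <-] [b _ <-]; exists (a + b); rewrite ?mulrDr.
by move=> a _ [b _ <-]; exists (a * b) => //; rewrite mulrCA.
Qed.

(** By maximality of [P], the ideal [P + (x)] contains a power of [f] as soon as [x] is outside [P];
    multiplying two such relations shows that [P] is prime. *)
Lemma exists_prime_avoiding_powers I (f : R) : is_ideal I ->
  (forall n, ~ I (f ^+ n)) ->
  exists P, [/\ prime_ideal P, I `<=` P, ~ P f &
    forall x, ~ P x -> exists c n, P (x * c - f ^+ n)].
Proof.
move=> idI If.
pose avoid J := is_ideal J /\ forall n, ~ J (f ^+ n).
have [//|F F0 FP totF|P [[idP Pf] IP maxP]] := @Zorn_bigcup_above _ avoid I.
  split; first by apply: is_ideal_bigcup => // J /FP[].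
  by move=> n [J /FP[_ /(_ n)]].
have PE x : ~ P x -> exists c n, P (x * c - f ^+ n).
  move=> Px; apply: contrapT => nx.
  have idX := is_ideal_principal x.
  have E : ideal_add P (range (GRing.mul x)) = P.
    apply: maxP; last exact: ideal_add_subl.
    split; first exact: is_ideal_add.
    move=> n [p [_ [Pp [c _ <-] e]]]; apply: nx; exists c, n.
    by rewrite e opprD addrCA subrr addr0; exact: idealN.
  apply: Px; rewrite -E; apply: ideal_add_subr => //.
  by exists 1; rewrite ?mulr1.
exists P; split=> //; last by have := Pf 1%N; rewrite expr1.
split=> //; first by have := Pf 0%N; rewrite expr0.
move=> x y Pxy; apply: contrapT => /not_orP[/PE[c [n Px]] /PE[d [m Py]]].
apply: (Pf (n + m)%N); have [_ PD PM] := idP.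
rewrite (_ : f ^+ _ = c * d * (x * y) - (x * c * (y * d - f ^+ m) +
    f ^+ m * (x * c - f ^+ n))); last by rewrite exprD; ring.
by apply: idealB => //; [exact: PM|apply: PD; exact: PM].
Qed.

(** The image of [R/P] in [L] is generated over the field [k] by the images of [s], and [f]
    witnesses Goldman's condition for it; it is thus closed under inverses, that is, a field. *)
Lemma affine_goldman_maximal P (f : R) : affine R -> prime_ideal P -> ~ P f ->
  (forall x, ~ P x -> exists c n, P (x * c - f ^+ n)) -> maximal_ideal P.
Proof.
move=> [s gen_s] prP Pf PE; have [idP P1 _] := prP.
have [L [rho rhoP]] := prime_ideal_residue prP.
pose phi : {rmorphism k -> L} := rho \o in_alg R.
have [sub_phi sub_s SB SM] := adjoin_seqP (map rho s) phi.
pose S := adjoin_seq (map rho s) phi.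
have SE : S = range rho.
  apply/seteqP; split.
    apply: adjoin_seq_sub.
    - by move=> _ _ [a _ <-] [b _ <-]; exists (a + b); rewrite ?rmorphD.
    - by move=> _ _ [a _ <-] [b _ <-]; exists (a * b); rewrite ?rmorphM.
    - by move=> _ [a _ <-]; exists (a%:A).
    - by move=> _ /mapP[a _ ->]; exists a.
  move=> _ [x _ <-].
  pose T : {pred R} := fun x => `[< S (rho x) >].
  have TP y : reflect (S (rho y)) (y \in T) by exact: asboolP.
  apply/TP; apply: gen_s => [|y ys]; last by apply/TP/sub_s/map_f.
  have T1 : S 1 by apply: sub_phi; exists 1; rewrite ?rmorph1.
  have SN y : S y -> S (- y).
    move=> Sy; rewrite -sub0r; apply: (SB) => //.
    by rewrite -(subrr 1); exact: SB.
  have SD y z : S y -> S z -> S (y + z).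
    by move=> Sy Sz; rewrite -[z]opprK; apply: SB => //; exact: SN.
  split; first by apply/TP; rewrite rmorph1.
    move=> a y z /TP Sy /TP Sz; apply/TP; rewrite rmorphD; apply: SD => //.
    rewrite -mulr_algl rmorphM; apply: SM => //.
    by apply: sub_phi; exists a.
  by move=> y z /TP Sy /TP Sz; apply/TP; rewrite rmorphM; exact: SM.
have gS : goldman S.
  exists (rho f); split; first by rewrite SE; exists f.
    by apply/eqP => /rhoP.
  rewrite SE => _ [x _ <-] x0.
  have [|c [n e]] := PE x; first by move=> /rhoP e; rewrite e eqxx in x0.
  exists (rho c); [by exists c|exists n].
  by apply/eqP; rewrite -rmorphM -rmorphXn -subr_eq0 -rmorphB; apply/eqP/rhoP.
have invS : inv_closed S.
  apply: adjoin_seq_inv_closed gS => _ [a _ <-].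
  by exists a^-1 => //; rewrite fmorphV.
split=> //; first by move=> PT; apply: P1; rewrite PT.
move=> J idJ PJ.
have [JP|/existsNP[x /not_implyP[Jx Px]]] := pselect (J `<=` P).
  by left; apply/seteqP.
right; apply: ideal1 => //.
have x0 : rho x != 0 by apply/eqP => /rhoP.
have [c _ ec] : range rho (rho x)^-1.
  by rewrite -SE; apply: invS; rewrite SE; exists x.
have Pxc : P (x * c - 1).
  by apply/rhoP; rewrite rmorphB rmorphM ec rmorph1 mulfV ?subrr.
have [_ _ JM] := idJ.
rewrite (_ : 1 = c * x - (x * c - 1)); last by ring.
by apply: idealB; [|exact: JM|exact: PJ].
Qed.

Lemma affine_jacobson I (f : R) : affine R -> is_ideal I ->
  (forall n, ~ I (f ^+ n)) ->
  exists M, [/\ maximal_ideal M, I `<=` M & ~ M f].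
Proof.
move=> affR idI If.
have [P [prP IP Pf PE]] := exists_prime_avoiding_powers idI If.
by exists P; split=> //; exact: affine_goldman_maximal PE.
Qed.

End Jacobson.

(** * Differential cores of prime ideals in characteristic zero *)

Section DifferentialCore.
Variables (k : fieldType) (R : comAlgType k).
Implicit Types (d : derivation R) (I M P : set R).

Lemma maximal_prime_ideal M : maximal_ideal M -> prime_ideal M.
Proof.
move=> maxM; have [idM MT _] := maxM; split=> //.
  by move=> /(ideal1 idM).
move=> x y Mxy; have [_ _ MM] := idM.
have [|xM|yM] :=
    maximal_ideal_prime maxM (is_ideal_principal x) (is_ideal_principal y).
- move=> _ [n [u [v [xu yv ->]]]].
  have [M0 MD _] := idM; elim/big_ind: _ => // i _.
  have [a _ <-] := xu i; have [b _ <-] := yv i.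
  by rewrite mulrACA mulrC; exact: MM.
- by left; apply: xM; exists 1; rewrite ?mulr1.
- by right; apply: yM; exists 1; rewrite ?mulr1.
Qed.

Lemma iter_derivation0 d n : iter n d 0 = 0.
Proof. by elim: n => //= n ->; rewrite raddf0. Qed.

Lemma iter_derivationD d n (x y : R) :
  iter n d (x + y) = iter n d x + iter n d y.
Proof. by elim: n => //= n ->; rewrite raddfD. Qed.

Lemma iter_derivationM d n (x y : R) : iter n d (x * y) =
  \sum_(i < n.+1) (iter i d x * iter (n - i) d y) *+ 'C(n, i).
Proof.
elim: n => [|n IH]; first by rewrite big_ord1 bin0.
rewrite iterS IH raddf_sum /=.
under eq_bigr do rewrite raddfMn /= derivationM mulrnDl.
rewrite big_split /= [X in _ + X = _]big_ord_recl [RHS]big_ord_recl /=.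
under [in RHS]eq_bigr do rewrite binS mulrnDr subSS.
rewrite [in RHS]big_split /= [X in _ = _ + (X + _)]big_ord_recr /=.
rewrite [in X in _ = _ + (_ + X + _)]bin_small // mulr0n addr0 !bin0 subn0.
rewrite [LHS]addrC -!addrA; congr (_ + (_ + _)).
apply: eq_bigr => i _.
by have -> : (n - i = (n - bump 0 i).+1)%N by exact: esym (subnSK (ltn_ord i)).
Qed.

(** For an ideal [P], this is the largest [d]-stable ideal inside [P]. *)
Definition derivation_core d P : set R := [set x | forall n, P (iter n d x)].

Lemma derivation_core_sub d P : derivation_core d P `<=` P.
Proof. by move=> x /(_ 0%N). Qed.

Hypothesis k_char0 : [pchar k] =i pred0.

Lemma is_ideal_derivation_core d P :
  is_ideal P -> is_ideal (derivation_core d P).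
Proof.
move=> [P0 PD PM]; split=> [n|x y Px Py n|a x Px n].
- by rewrite iter_derivation0.
- by rewrite iter_derivationD; exact: PD.
- rewrite iter_derivationM; elim/big_ind: _ => // i _.
  by rewrite -mulrnAl; exact: PM.
Qed.

(** Characteristic zero enters here: [n%:R] is invertible in [k]. *)
Lemma ideal_mulrn I x n : is_ideal I -> (0 < n)%N -> I (x *+ n) -> I x.
Proof.
move=> [_ _ IM] n0 Ix; have nk0 : n%:R != 0 :> k.
  by rewrite (pcharf0P _).1 // -lt0n.
rewrite (_ : x = (n%:R^-1)%:A * (x *+ n)); first exact: IM.
by rewrite mulr_algl -[x *+ n]scaler_nat scalerA mulVf // scale1r.
Qed.

(** Let [n] and [m] be least such that [iter n d x] and [iter m d y] leave [P]. In Leibniz's formula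
    for [iter (n + m) d (x * y)], every term except the one of index [n] lies in [P]. *)
Lemma prime_ideal_derivation_core d P :
  prime_ideal P -> prime_ideal (derivation_core d P).
Proof.
move=> [idP P1 PM]; have [P0 PD PMl] := idP; split.
- exact: is_ideal_derivation_core.
- by move=> /derivation_core_sub.
move=> x y Pxy; apply: contrapT => /not_orP[].
have first_iter z : ~ derivation_core d P z ->
    exists n, ~ P (iter n d z) /\ forall i, (i < n)%N -> P (iter i d z).
  move=> /existsNP nz; have ez : exists n, `[< ~ P (iter n d z) >].
    by have [n Pn] := nz; exists n; apply/asboolP.
  have [n /asboolP Pn minn] := ex_minnP ez; exists n; split=> // i ltin.
  apply: contrapT => /asboolP /minn; by rewrite leqNgt ltin.
move=> /first_iter[n [Pn ltn]] /first_iter[m [Pm ltm]].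
have [] // : P (iter n d x) \/ P (iter m d y).
apply: PM; apply: (@ideal_mulrn _ _ 'C(n + m, n)) => //.
  by rewrite bin_gt0 leq_addr.
have := Pxy (n + m)%N; rewrite iter_derivationM.
have ltn_nm : (n < (n + m).+1)%N by rewrite ltnS leq_addr.
rewrite (bigD1 (Ordinal ltn_nm)) //= addKn => Psum.
rewrite -[X in P X](addrK (\sum_(i < (n + m).+1 | i != Ordinal ltn_nm)
  (iter i d x * iter (n + m - i) d y) *+ 'C(n + m, i))).
apply: idealB => //; elim/big_ind: _ => // i ni.
rewrite -mulr_natl; apply: (PMl).
have [lti|lti|ei] := ltngtP i n.
- by rewrite mulrC; apply: PMl; exact: ltn.
- by apply: (PMl); apply: ltm; rewrite ltn_subLR ?ltn_add2r // -ltnS.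
- by case/eqP: ni; apply/val_inj.
Qed.

Lemma prime_ideal_delta_core Delta P :
  prime_ideal P -> prime_ideal (delta_core Delta P).
Proof.
move=> prP; have [idP _ _] := prP.
have [[idC dC] CP Cmax] := delta_core_largest Delta idP.
set C := delta_core Delta P in idC dC CP Cmax *.
(* A minimal prime is obtained as a maximal complement, a chain of primes having a prime
   intersection. *)
have [] := @Zorn_bigcup_above _
  [set X | prime_ideal (~` X) /\ C `<=` ~` X] (~` P).
- by rewrite /= setCK.
- move=> F [X0 FX0] FP totF; rewrite /= setC_bigcup; split; last first.
    by move=> x Cx X /FP[_]; apply.
  split; first split.
  - by move=> X /FP[[[X1 _ _] _ _] _].
  - move=> x y Fx Fy X FX; have [[[_ XD _] _ _] _] := FP _ FX.
    by apply: XD; [exact: Fx|exact: Fy].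
  - move=> a x Fx X FX; have [[[_ _ XM] _ _] _] := FP _ FX.
    by apply: XM; exact: Fx.
  - by move=> /(_ _ FX0); have [[_ X01 _] _] := FP _ FX0.
  move=> x y Fxy; apply: contrapT => /not_orP[/existsNP[X /not_implyP[FX Xx]]].
  move=> /existsNP[Y /not_implyP[FY Yy]].
  (* The complement of the larger set is a prime containing neither [x] nor [y]. *)
  wlog XY : x y X Y FX Xx FY Yy Fxy / X `<=` Y.
    move=> wl; have [XY|YX] := totF _ _ FX FY; first exact: (wl x y X Y).
    by apply: (wl y x Y X) => // Z FZ; rewrite mulrC; exact: Fxy.
  have [[_ _ YM] _] := FP _ FY.
  by have [] := YM x y (Fxy _ FY); [apply: contra_not Xx; exact: subsetC XY x|].
move=> B [[prB CB] PB maxB]; set N := ~` B in prB CB; have [idN _ _] := prB.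
have NP : N `<=` P by rewrite -[P]setCK; exact: subsetC.
suff dN : delta_ideal Delta N.
  by rewrite (_ : C = N) //; apply/seteqP; split=> //; exact: Cmax.
split=> // d Dd x Nx.
have dN : derivation_core d N `<=` N by exact: derivation_core_sub.
(* The core of [N] for [d] alone is a prime between [C] and [N], so it equals [N] by minimality. *)
have BN : ~` derivation_core d N = B.
  apply: maxB; last by rewrite -[B]setCK; exact: subsetC.
  rewrite /= setCK; split; first exact: prime_ideal_derivation_core.
  by move=> z Cz n; apply: CB; elim: n => //= n; exact: dC.
have /(_ 1%N) // : derivation_core d N x.
by apply: contrapT => nx; apply: Nx; rewrite -BN.
Qed.

End DifferentialCore.

(** * Continuity, surjectivity and the quotient topology *)

Section Quotient.
Variables (k : fieldType) (R : comAlgType k) (Delta : set (derivation R)).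

(** Both sides say that some Delta-ideal lies between [I] and [M]. *)
Lemma pi_m_zeros (I : set R) : 
  @pi_m k R Delta @^-1` zariski_zeros I = zariski_zeros (delta_hull Delta I).
Proof.
apply/seteqP; split=> M; have [idM _ _] := zariski_ideal_mem M;
  have [dC CM Cmax] := delta_core_largest Delta idM.
- by move=> IC; apply: subset_trans CM; rewrite delta_hull_sub.
- move=> HM; rewrite /= /zariski_zeros /= -(delta_hull_sub I dC).
  by apply: Cmax => //; exact: delta_ideal_hull.
Qed.

Lemma continuous_pi_m : continuous (@pi_m k R Delta).
Proof.
apply/continuous_closedP => A /zariski_closedP[I idI ->].
rewrite pi_m_zeros; apply/zariski_closedP; exists (delta_hull Delta I) => //.
by case: (delta_ideal_hull Delta I).
Qed.

Lemma surj_pi_m : set_surj setT setT (@pi_m k R Delta).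
Proof.
move=> P _; have [M maxM PM] := zariski_ideal_mem P.
by exists (Zariski _ maxM) => //; apply: zariski_ideal_inj; rewrite PM.
Qed.

Lemma locally_closed_witness (Q : delta_spec Delta) :
  locally_closed_point Q -> exists2 l : R, ~ (Q : set R) l &
    forall Q' : delta_spec Delta,
      (Q : set R) `<=` Q' -> ~ (Q' : set R) l -> Q' = Q.
Proof.
move=> [U]; rewrite nbhsE => -[V [oV VQ] VU] [C /zariski_closedP[J idJ CJ] CU].
have : closed (~` V) by exact: open_closedC.
move=> /zariski_closedP[L idL VL].
have : ~ (~` V) Q by apply.
rewrite VL => /existsNP[l /not_implyP[Ll Ql]]; exists l => // Q' QQ' Q'l.
have : (C `&` U) Q'.
  split; last first.
    apply: VU; apply: contrapT => nV.
    by have : (~` V) Q' by []; rewrite VL => /(_ _ Ll).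
  rewrite CJ; have [+ _] : (C `&` U) Q by rewrite CU.
  by rewrite CJ => JQ; exact: subset_trans QQ'.
by rewrite CU.
Qed.

Hypothesis k_char0 : [pchar k] =i pred0.
Hypothesis R_affine : affine R.

(* The fibre of [pi_m] over [P] is dense in the set of maximal ideals above [P]. *)
Lemma fiber_dense (P : delta_prim Delta) (f : R) :
  (forall Q : delta_spec Delta,
     delta_primitive Delta Q -> locally_closed_point Q) ->
  ~ (P : set R) f ->
  exists2 M : maxspec R, pi_m Delta M = P & ~ (M : set R) f.
Proof.
move=> lc Pf; have primP := zariski_ideal_mem P.
have dprP := delta_primitive_prime primP.
have [l Pl lP] := locally_closed_witness (lc (Zariski _ dprP) primP).
have prP : prime_ideal P.
  have [M /maximal_prime_ideal prM ->] := primP.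
  exact: prime_ideal_delta_core.
have [idP _ PM] := prP.
(* Avoiding [l * f] keeps [f] outside [M] and [l] outside its core, which forces that core to be
   [P]. *)
have [n|M [maxM PsM Mlf]] := @affine_jacobson k R P (l * f) R_affine idP.
  by move=> /(prime_idealX prP)/PM[].
have [idM MT _] := maxM; have [_ _ MM] := idM.
have [dC CM Cmax] := delta_core_largest Delta idM.
exists (Zariski _ maxM); last by move=> Mf; apply: Mlf; exact: MM.
have primC : delta_primitive Delta (delta_core Delta M) by exists M.
apply: zariski_ideal_inj => /=.
have [dP _ _] := dprP.
suff /(congr1 (@zariski_ideal _ _ _ _ _)) :
  Zariski _ (delta_primitive_prime primC) = Zariski _ dprP
    :> delta_spec Delta by [].
apply: lP; first exact: Cmax.
by move=> /CM Ml; apply: Mlf; rewrite mulrC; exact: MM.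
Qed.

Lemma quotient_pi_m :
  (forall Q : delta_spec Delta,
     delta_primitive Delta Q -> locally_closed_point Q) ->
  topological_quotient (@pi_m k R Delta).
Proof.
move=> lc; split=> [|W]; first exact: surj_pi_m.
split; first by move: W; apply/continuous_closedP; exact: continuous_pi_m.
move=> /zariski_closedP[I idI WI]; apply/zariski_closedP; exists I => //.
apply/seteqP; split=> P.
  move=> WP x Ix; apply: contrapT => Px.
  have [M MP Mx] := fiber_dense lc Px.
  have : (pi_m Delta @^-1` W) M by rewrite /= MP.
  by rewrite WI => /(_ _ Ix).
move=> IP; have [M _ MP] := @surj_pi_m P Logic.I.
have [idM _ _] := zariski_ideal_mem M.
have [_ CM _] := delta_core_largest Delta idM.
suff : (pi_m Delta @^-1` W) M by rewrite /= MP.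
by rewrite WI => x /IP; rewrite -MP; exact: CM.
Qed.

End Quotient.

Unset Implicit Arguments.

Theorem theorem1p5 (k : fieldType) (k_char0 : [pchar k] =i pred0)
    (R : comAlgType k) (Delta : set (derivation R)) (R_affine : affine R) :
  (continuous (@pi_m k R Delta) /\ set_surj setT setT (@pi_m k R Delta)) /\
  ((forall Q : delta_spec Delta,
      delta_primitive Delta Q -> locally_closed_point Q) ->
   topological_quotient (@pi_m k R Delta)).
Proof.
split; first by split; [exact: continuous_pi_m|exact: surj_pi_m].
exact: quotient_pi_m.
Qed.
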